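(* There exists an oriented matroid of rank $3$ on $13$ points whose realization space is connected and non-irreducible.
   Context: Let $E=\{1,\dots,n\}$ and let $r\ge 1$ be an integer. An oriented matroid $\mathcal{M}=\mathcal{M}(E,\chi)$ of rank $r$ on $E$ (that is, on $n$ points) is defined by a map $\chi:E^r\to\{-1,0,+1\}$, called its chirotope, such that: (1) $\chi$ is not identically zero; (2) $\chi$ is alternating: $\chi(i_{\sigma(1)},\dots,i_{\sigma(r)})=\operatorname{sgn}(\sigma)\,\chi(i_1,\dots,i_r)$ for all $i_1,\dots,i_r\in E$ and all permutations $\sigma$ of $\{1,\dots,r\}$; (3) for all $i_1,\dots,i_r,j_1,\dots,j_r\in E$ such that $\chi(j_k,i_2,\dots,i_r)\cdot\chi(j_1,\dots,j_{k-1},i_1,j_{k+1},\dots,j_r)\ge 0$ for every $k=1,\dots,r$, we have $\chi(i_1,\dots,i_r)\cdot\chi(j_1,\dots,j_r)\ge 0$. For a real $r\times n$ matrix $X=(x_1,\dots,x_n)$ of rank $r$ with columns $x_i\in\mathbb{R}^r$, its chirotope is $\chi_X:E^r\to\{-1,0,+1\}$, $\chi_X(i_1,\dots,i_r)=\operatorname{sgn}\det(x_{i_1},\dots,x_{i_r})$. A realization of $\mathcal{M}(E,\chi)$ is a real $r\times n$ matrix $X$ of rank $r$ with $\chi_X=\chi$ or $\chi_X=-\chi$. Two realizations $X,X'$ are linearly equivalent if $X'=AX$ for some $A\in GL(r,\mathbb{R})$. The realization space $\mathcal{R}(\mathcal{M})$ is the set of all linear equivalence classes of realizations of $\mathcal{M}$,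 with the quotient topology induced from $\mathbb{R}^{rn}$ (the set of realizations carrying the subspace topology). Via $X\mapsto$ row space of $X$, $\mathcal{R}(\mathcal{M})$ is a semialgebraic subset of the real Grassmannian of $r$-dimensional subspaces of $\mathbb{R}^n$. Connectedness refers to the (Euclidean) quotient topology above. A nonempty semialgebraic set is irreducible if it is not the union of two proper subsets that are relatively closed in the Zariski topology (equivalently, its Zariski closure is irreducible); non-irreducible means not irreducible. *)

(* Defs.v *)
(* The notations of mpoly clash with those of mathcomp-analysis. *)
From mathcomp Require mpoly.
Import -(notations) mpoly.
From mathcomp Require Import all_boot all_order all_algebra perm generic_quotient.
From mathcomp Require Import all_classical all_reals all_analysis.

Set Implicit Arguments.
Unset Strict Implicit.
Unset Printing Implicit Defensive.

Import Order.TTheory GRing.Theory Num.Theory.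
Import numFieldNormedType.Exports.

Local Open Scope classical_set_scope.
Local Open Scope ring_scope.
Local Open Scope quotient_scope.

(* E^r, with 'I_n for E. *)
Definition etuple (r n : nat) := {ffun 'I_r -> 'I_n}.

Definition tset (r n : nat) (i : etuple r n) (k : 'I_r) (e : 'I_n) :
    etuple r n :=
  [ffun l => if l == k then e else i l].

Definition alternating_map (r n : nat) (chi : etuple r n -> int) : Prop :=
  forall (i : etuple r n) (s : 'S_r), chi [ffun k => i (s k)] = (-1) ^+ s * chi i.

(* o stands for the first index, whence the hypothesis 0 < r below. *)
Definition chirotope_exchange (r n : nat) (o : 'I_r) (chi : etuple r n -> int) :
    Prop :=
  forall i j : etuple r n,
    (forall k : 'I_r, 0 <= chi (tset i o (j k)) * chi (tset j k (i o))) ->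
    0 <= chi i * chi j.

Record orientedMatroid (r n : nat) := OrientedMatroid {
  chirotope :> etuple r n -> int;
  om_rank_gt0 : (0 < r)%N;
  om_sign : forall i, chirotope i \in [:: -1; 0; 1];
  om_neq0 : exists i, chirotope i != 0;
  om_alternating : alternating_map chirotope;
  om_exchange : chirotope_exchange (Ordinal om_rank_gt0) chirotope
}.

Section Realizations.
Variables (R : realType) (r n : nat).
Implicit Types (X : 'M[R]_(r, n)) (M : orientedMatroid r n).

Definition mx_chirotope X (i : etuple r n) : int := sgz (\det (colsub i X)).

Definition realization M X : Prop :=
  \rank X = r /\
  ((forall i, mx_chirotope X i = M i) \/ (forall i, mx_chirotope X i = - M i)).

Definition realizations M : set 'M[R]_(r, n) := [set X | realization M X].

Definition linearly_equivalent X X' : Prop :=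
  exists2 A : 'M[R]_r, A \in unitmx & X' = A *m X.

Definition real_equiv M : rel (set_type (realizations M)) :=
  fun u v => `[< linearly_equivalent (val u) (val v) >].

Lemma real_equiv_refl M : reflexive (real_equiv (M := M)).
Proof. by move=> u; apply/asboolP; exists 1%:M; rewrite ?unitmx1 ?mul1mx. Qed.

Lemma real_equiv_sym M : symmetric (real_equiv (M := M)).
Proof.
suff H u v : real_equiv (M := M) u v -> real_equiv (M := M) v u.
  by move=> u v; apply/idP/idP => /H.
move=> /asboolP[A Au E]; apply/asboolP.
by exists (invmx A); rewrite ?unitmx_inv// E mulKmx.
Qed.

Lemma real_equiv_trans M : transitive (real_equiv (M := M)).
Proof.
move=> v u w /asboolP[A Au EA] /asboolP[B Bu EB]; apply/asboolP.
by exists (B *m A); rewrite ?unitmx_mul ?Bu// EB EA mulmxA.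
Qed.

Canonical real_equivRel M :=
  EquivRel (real_equiv (M := M))
    (@real_equiv_refl M) (@real_equiv_sym M) (@real_equiv_trans M).

(* [set_type (realizations M)] carries the subspace topology. *)
Definition realization_space M : topologicalType :=
  quotient_topology {eq_quot (real_equivRel M)}.

Definition row_space X : {vspace 'rV[R]_n} := <<[seq row i X | i : 'I_r]>>%VS.

Lemma linearly_equivalent_row_space X X' :
  linearly_equivalent X X' -> row_space X = row_space X'.
Proof.
have sub A Y : (row_space (A *m Y) <= row_space Y)%VS.
  apply/span_subvP => _ /mapP[i _ ->].
  rewrite row_mul mulmx_sum_row; apply: rpred_sum => j _.
  by rewrite rpredZ// memv_span// fintype.image_f.
move=> [A Au ->]; apply/eqP; rewrite eqEsubv sub andbT.
by rewrite -{1}(mulKmx Au X) sub.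
Qed.

(* The embedding of the realization space into the Grassmannian; independent of
   the representative by [linearly_equivalent_row_space]. *)
Definition class_row_space M (q : realization_space M) : {vspace 'rV[R]_n} :=
  row_space (val (repr (q : {eq_quot (real_equivRel M)}))).

End Realizations.

Section ZariskiGrassmannian.
Variables (R : realType) (r n : nat).

Definition grassmannian : set {vspace 'rV[R]_n} := [set U | \dim U = r].

(* Indexed by all of E^r rather than by r-subsets: the extra coordinates are 0
   or, up to sign, duplicates. *)
Definition plucker (X : 'M[R]_(r, n)) (k : 'I_#|{: etuple r n}|) : R :=
  \det (colsub (enum_val k : etuple r n) X).

(* Zero loci of homogeneous polynomials under the Plücker embedding; the
   coordinates of U are defined up to a nonzero factor, which does not
   matter for homogeneous equations. *)
Definition zariski_closed (Z : set {vspace 'rV[R]_n}) : Prop :=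
  exists S : set (mpoly #|{: etuple r n}| R),
    (forall p, S p -> exists d : nat, p \is ishomog1 d mdeg) /\
    Z = [set U | grassmannian U /\
           forall X : 'M[R]_(r, n), row_space X = U ->
           forall p, S p -> meval (plucker X) p = 0].

Definition zariski_closed_in (A B : set {vspace 'rV[R]_n}) : Prop :=
  exists2 Z, zariski_closed Z & B = A `&` Z.

Definition zariski_irreducible (A : set {vspace 'rV[R]_n}) : Prop :=
  A !=set0 /\
  ~ (exists B C, [/\ zariski_closed_in A B, zariski_closed_in A C,
                     B `<` A, C `<` A & A = B `|` C]).

End ZariskiGrassmannian.

(* Main.v *)
(* A point of the realization space is a configuration of 13 points of the projective
   plane. In the frame of the first four points, the prescribed collinearities up to
   one determine the configuration from two parameters a and t, and the last
   collinearity reads (1 - a) (t - 2 a) = 0 up to factors that are nonzero brackets. So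
   the realization space is the union of a piece of the line a = 1 and a piece of the
   line t = 2 a; on each of them the sign conditions cut out an interval, and both
   intervals contain the crossing point a = 1, t = 2. Hence the space is connected, but
   each of the two equations, written as a homogeneous polynomial in the brackets,
   defines a proper closed subset. The configuration was found by a computer search. *)
Require Import Defs.
From mathcomp Require mpoly.
Import -(notations) mpoly.
From mathcomp Require Import all_boot all_order all_algebra perm generic_quotient.
From mathcomp Require Import ring lra.
From mathcomp Require Import all_classical all_reals all_analysis.

Set Implicit Arguments.
Unset Strict Implicit.
Unset Printing Implicit Defensive.

Import Order.TTheory GRing.Theory Num.Theory.
Import numFieldNormedType.Exports.

Local Open Scope classical_set_scope.
Local Open Scope ring_scope.

(** * Chirotopes of real matrices *)

Local Notation "''r_' k" := (@Ordinal 3 k isT) (at level 8, k at level 2).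
Local Notation "''p_' k" := (@Ordinal 13 k isT) (at level 8, k at level 2).

(** The determinant of three columns, expanded along the first of them so that [ring] and [field]
    apply directly. *)
Definition bracket (K : comNzRingType) n (X : 'M[K]_(3, n)) (a b c : 'I_n) : K :=
  X 'r_0 a * (X 'r_1 b * X 'r_2 c - X 'r_2 b * X 'r_1 c)
  - X 'r_1 a * (X 'r_0 b * X 'r_2 c - X 'r_2 b * X 'r_0 c)
  + X 'r_2 a * (X 'r_0 b * X 'r_1 c - X 'r_1 b * X 'r_0 c).

Lemma det_mx33 (K : comNzRingType) (f : nat -> nat -> K) :
  \det (\matrix_(i < 3, j < 3) f i j) =
  f 0 0 * (f 1 1 * f 2 2 - f 2 1 * f 1 2)
  - f 1 0 * (f 0 1 * f 2 2 - f 2 1 * f 0 2)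
  + f 2 0 * (f 0 1 * f 1 2 - f 1 1 * f 0 2).
Proof.
rewrite (expand_det_col _ ord0) !big_ord_recl big_ord0 /cofactor.
rewrite !(expand_det_col _ ord0) !big_ord_recl !big_ord0 /cofactor !det_mx11.
rewrite !mxE /= /bump /= !addn0 !add0n !addn1 /= !expr0 !expr1 !expr2.
ring.
Qed.

Lemma det_bracket (K : comNzRingType) n (X : 'M[K]_(3, n)) (i : etuple 3 n) :
  \det (colsub i X) = bracket X (i 'r_0) (i 'r_1) (i 'r_2).
Proof.
pose f k l := X (inord k) (i (inord l)).
have -> : colsub i X = \matrix_(k, l) f k l.
  by apply/matrixP => k l; rewrite !mxE /f !inord_val.
have e (m : nat) (h : (m < 3)%N) : inord m = Ordinal h by apply/val_inj/inordK.
by rewrite (det_mx33 f) /f (e 0%N isT) (e 1%N isT) (e 2%N isT).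
Qed.

Lemma mx_chirotope_alternating (R : realType) r n (X : 'M[R]_(r, n)) :
  alternating_map (mx_chirotope X).
Proof.
move=> i s; rewrite /mx_chirotope.
have -> : colsub [ffun k => i (s k)] X = col_perm s (colsub i X).
  by apply/matrixP => k l; rewrite !mxE ffunE.
rewrite col_permE det_mulmx det_perm odd_permV mulrC sgzM; congr (_ * _).
by case: (odd_perm s); rewrite ?expr0 ?expr1 ?sgz1 ?sgzN1.
Qed.

(* The Grassmann-Plücker relation writes [det(i) det(j)] as the sum of the three
   products that are assumed nonnegative. *)
Lemma mx_chirotope_exchange (R : realType) n (X : 'M[R]_(3, n)) (h : (0 < 3)%N) :
  chirotope_exchange (Ordinal h) (mx_chirotope X).
Proof.
move=> i j; have {h}-> : Ordinal h = 'r_0 by apply: val_inj.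
rewrite /mx_chirotope -sgzM sgz_ge0 => H.
have {}H k : 0 <= \det (colsub (tset i 'r_0 (j k)) X) *
                  \det (colsub (tset j k (i 'r_0)) X).
  by rewrite -sgz_ge0 sgzM.
move: (H 'r_0) (H 'r_1) (H 'r_2); rewrite !det_bracket /tset !ffunE /=.
set x := bracket _ _ _ _ * _; set y := bracket _ _ _ _ * _.
set z := bracket _ _ _ _ * _ => x0 y0 z0.
suff -> : bracket X (i 'r_0) (i 'r_1) (i 'r_2) *
          bracket X (j 'r_0) (j 'r_1) (j 'r_2) = x + y + z by rewrite !addr_ge0.
by rewrite /x /y /z /bracket; ring.
Qed.

Section MatrixOrientedMatroid.
Variables (R : realType) (n : nat) (X : 'M[R]_(3, n)).
Hypothesis X_neq0 : exists i, mx_chirotope X i != 0.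

Lemma mx_chirotope_sign i : mx_chirotope X i \in [:: -1; 0; 1].
Proof. by rewrite /mx_chirotope !inE; case: sgzP. Qed.

(** Starting from a matrix replaces a check of the exchange axiom over all pairs of triples by the
    Grassmann-Plücker relation. *)
Definition mx_orientedMatroid : orientedMatroid 3 n :=
  @OrientedMatroid 3 n (mx_chirotope X) isT mx_chirotope_sign X_neq0
    (mx_chirotope_alternating X) (@mx_chirotope_exchange R n X isT).

End MatrixOrientedMatroid.

(** * Signs of integer polynomials *)

Section PolynomialSign.
Implicit Types (p q : seq int) (c : int).

(** Polynomials are coefficient lists, constant term first, so that signs can be decided by
    computation. *)
Fixpoint padd p q : seq int :=
  match p, q with
  | [::], _ => q
  | _, [::] => p
  | a :: p', b :: q' => a + b :: padd p' q'
  end.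

Arguments padd : simpl nomatch.

Definition pscale c p := [seq c * a | a <- p].

Definition psub p q := padd p (pscale (-1) q).

Fixpoint pmul p q : seq int :=
  if p is a :: p' then padd (pscale a q) (0 :: pmul p' q) else [::].

(* [peval p x = peval e z + x * peval o z] for [(e, o) := even_odd c p] and
   [z := x ^+ 2 - c]. *)
Fixpoint even_odd c p : seq int * seq int :=
  if p is a :: p' then
    let: (e, o) := even_odd c p' in (padd (a :: o) (pscale c o), e)
  else ([::], [::]).

(** A sufficient test for positivity when [x > 0] and [z = x ^+ 2 - c > 0]. Expanding in [z] keeps
    the coefficients integral even if the square root of [c] is irrational. *)
Definition ppos c p :=
  let: (e, o) := even_odd c p in
  all (>= 0) e && all (>= 0) o && (has (> 0) e || has (> 0) o).

(** [None] means that the test is inconclusive. *)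
Definition psign c p : option int :=
  if ppos c p then Some 1 else
  if ppos c (pscale (-1) p) then Some (-1) else
  if all (eq_op^~ 0) p then Some 0 else None.

Variable R : realType.
Implicit Types (x : R).

Definition peval p x : R := foldr (fun a y => a%:~R + x * y) 0 p.

Lemma peval_add p q x : peval (padd p q) x = peval p x + peval q x.
Proof.
elim: p q => [|a p IH] [|b q] /=; rewrite ?add0r ?addr0 //.
by rewrite /= IH rmorphD /=; ring.
Qed.

Lemma peval_scale c p x : peval (pscale c p) x = c%:~R * peval p x.
Proof. by elim: p => [|a p IH] /=; rewrite ?mulr0 // IH rmorphM /=; ring. Qed.

Lemma peval_sub p q x : peval (psub p q) x = peval p x - peval q x.
Proof. by rewrite peval_add peval_scale rmorphN1 mulN1r. Qed.

Lemma peval_mul p q x : peval (pmul p q) x = peval p x * peval q x.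
Proof.
by elim: p => [|a p IH] /=; rewrite ?mul0r // peval_add peval_scale /= IH; ring.
Qed.

(** With [x ^+ 2 = z + c], one has [a + x * (e + x * o) = (a + z * o + c * o) + x * e]. *)
Lemma peval_even_odd c p x : let: (e, o) := even_odd c p in
  peval p x = peval e (x ^+ 2 - c%:~R) + x * peval o (x ^+ 2 - c%:~R).
Proof.
elim: p => [|a p] /=; first by rewrite mulr0 addr0.
by case: even_odd => e o ->; rewrite peval_add peval_scale /=; ring.
Qed.

Lemma peval_ge0 p x : 0 < x -> all (>= 0) p -> 0 <= peval p x.
Proof.
move=> x0; elim: p => //= a p IH /andP[a0 /IH p0].
by rewrite addr_ge0 ?ler0z // mulr_ge0 // ltW.
Qed.

Lemma peval_gt0 p x : 0 < x -> all (>= 0) p -> has (> 0) p -> 0 < peval p x.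
Proof.
move=> x0; elim: p => //= a p IH /andP[a0 p0] /orP[agt0|/(IH p0) pgt0].
  by rewrite ltr_pwDl ?ltr0z // mulr_ge0 ?(ltW x0) // peval_ge0.
by rewrite ltr_wpDl ?ler0z // mulr_gt0.
Qed.

Lemma ppos_gt0 c p x : 0 < x -> c%:~R < x ^+ 2 -> ppos c p -> 0 < peval p x.
Proof.
move=> x0 xc; rewrite /ppos; have := peval_even_odd c p x.
case: even_odd => e o -> /andP[/andP[e0 o0] /orP[pos|pos]];
  have z0 : 0 < x ^+ 2 - c%:~R by rewrite subr_gt0.
  by rewrite ltr_pwDl ?peval_gt0 // mulr_ge0 ?(ltW x0) // peval_ge0.
by rewrite ltr_wpDl ?peval_ge0 // mulr_gt0 // peval_gt0.
Qed.

Lemma psignP c p x s : 0 < x -> c%:~R < x ^+ 2 -> psign c p = Some s ->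
  sgz (peval p x) = s.
Proof.
move=> x0 xc; rewrite /psign; case: ifP => [/(ppos_gt0 x0 xc) h [<-]|_].
  exact: gtr0_sgz.
case: ifP => [/(ppos_gt0 x0 xc)|_].
  by rewrite peval_scale rmorphN1 mulN1r oppr_gt0 => h [<-]; exact: ltr0_sgz.
case: ifP => // p0 [<-]; suff -> : peval p x = 0 by rewrite sgz0.
by elim: p p0 => //= a p IH /andP[/eqP -> /IH ->]; rewrite mulr0 addr0.
Qed.

End PolynomialSign.

(** * The two branches *)

(* Coefficient lists of the columns, in the frame of the first four points. The
   general point with vanishing bracket [2 11 12] has [a = 1] or [t = 2 * a] in the
   coordinates of [normal_form] below; up to scaling of the columns the branches
   are [a = 1, t = 1 + x / 2] ([true]) and [a = (1 + x) / 2, t = 1 + x] ([false]). *)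
Definition branch (b : bool) : seq (seq (seq int)) :=
  [:: [:: [:: 1]; [::]; [::]], [:: [::]; [:: 1]; [::]],
      [:: [::]; [::]; [:: 1]], [:: [:: 1]; [:: 1]; [:: 1]] &
   if b then
   [:: [:: [:: 1]; [:: 2]; [:: 2]];
       [:: [:: 2; 1]; [:: 2]; [::]];
       [:: [:: 1]; [:: 2]; [:: 1]];
       [:: [::]; [:: 2; 2]; [:: 2; 1]];
       [:: [:: 2; 2]; [::]; [:: 0; 1]];
       [:: [:: 2; 1]; [:: 2]; [:: 1]];
       [:: [::]; [:: 4; 4]; [:: 4; 3]];
       [:: [:: -2; -1]; [:: 0; 2]; [:: 2; 2]];
       [:: [:: -2; -1]; [:: 0; 2]; [:: 0; 1]]]
   else
   [:: [:: [:: 1; 1]; [:: 3; 1]; [:: 3; 1]];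
       [:: [:: 1; 1]; [:: 1]; [::]];
       [:: [:: 1; 1]; [:: 3; 1]; [:: 1; 1]];
       [:: [::]; [:: 2; 1]; [:: 1; 1]];
       [:: [:: 2; 1]; [::]; [:: 1]];
       [:: [:: 3; 4; 1]; [:: 3; 1]; [:: 1; 1]];
       [:: [::]; [:: 6; 5; 1]; [:: 5; 4; 1]];
       [:: [:: -3; -4; -1]; [:: 3; 4; 1]; [:: 7; 4; 1]];
       [:: [:: -3; -1]; [:: 3; 1]; [:: 1; 1]]]].

Definition entry b j i : seq int := nth [::] (nth [::] (branch b) j) i.

(** It has the same shape as [bracket], so that evaluation turns one into the other by rewriting. *)
Definition pbracket b i j k : seq int :=
  let e := entry b in
  padd (psub (pmul (e i 0) (psub (pmul (e j 1) (e k 2)) (pmul (e j 2) (e k 1))))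
             (pmul (e i 1) (psub (pmul (e j 0) (e k 2)) (pmul (e j 2) (e k 0)))))
       (pmul (e i 2) (psub (pmul (e j 0) (e k 1)) (pmul (e j 1) (e k 0)))).

(** On the line [a = 1] the signs force [2 * t ^+ 2 - 4 * t + 1 > 0], which reads [x ^+ 2 > 2]; on
    the other line only [x > 0] remains. *)
Definition branch_bound (b : bool) : int := if b then 2 else 0.

(** The default of [odflt] never occurs for indices below 13, by [psign_pbracket]. *)
Definition chi i j k : int :=
  odflt 0 (psign (branch_bound false) (pbracket false i j k)).

(** This computation places both branches in the same oriented matroid: each bracket has a constant
    sign along a branch, and the two branches agree. *)
Lemma psign_pbracket b (i j k : 'I_13) :
  psign (branch_bound b) (pbracket b i j k) = Some (chi i j k).
Proof.
(* Ranging over [iota 0 13] keeps ordinals out of the computation. *)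
suff /allP/(_ i) : all (fun i => all (fun j => all (fun k =>
    psign (branch_bound b) (pbracket b i j k) == Some (chi i j k))
    (iota 0 13)) (iota 0 13)) (iota 0 13).
  rewrite mem_iota ltn_ord => /(_ isT)/allP/(_ j).
  rewrite mem_iota ltn_ord => /(_ isT)/allP/(_ k).
  by rewrite mem_iota ltn_ord => /(_ isT)/eqP.
by case: b; vm_compute.
Qed.

Section Branch.
Variable R : realType.
Implicit Types (b : bool) (x : R).

Definition branch_mx b x : 'M[R]_(3, 13) := \matrix_(i, j) peval (entry b j i) x.

Definition branch_dom b : set R := [set x | 0 < x /\ (branch_bound b)%:~R < x ^+ 2].

Lemma sgz_bracket_branch b x i j k : branch_dom b x ->
  sgz (bracket (branch_mx b x) i j k) = chi i j k.
Proof.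
move=> [x0 xb].
rewrite -(psignP x0 xb (psign_pbracket b i j k)) /bracket !mxE.
by rewrite !(peval_add, peval_sub, peval_mul).
Qed.

End Branch.

(** * Normal form of the realizations *)

Lemma ord3_ind (T : 'I_3 -> Prop) : T 'r_0 -> T 'r_1 -> T 'r_2 -> forall k, T k.
Proof.
move=> ? ? ? [[|[|[|//]]] h]; by rewrite (bool_irrelevance h isT).
Qed.

Lemma sum_ord3 (K : nmodType) (f : 'I_3 -> K) :
  \sum_k f k = f 'r_0 + f 'r_1 + f 'r_2.
Proof.
rewrite !big_ord_recl big_ord0 addr0 addrA.
by congr (f _ + f _ + f _); apply: val_inj.
Qed.

(** Linear equivalence does not rescale single columns, so the scalings remain as parameters of a
    realization. *)
Definition scale_cols (K : nzRingType) m n (lam : 'I_n -> K) (Y : 'M[K]_(m, n)) :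
  'M[K]_(m, n) := \matrix_(k, j) (lam j * Y k j).

Lemma scale_cols1 (K : nzRingType) m n (Y : 'M[K]_(m, n)) : scale_cols (fun=> 1) Y = Y.
Proof. by apply/matrixP => k j; rewrite !mxE mul1r. Qed.

Lemma bracket_mul (K : comNzRingType) n (A : 'M[K]_3) (Z : 'M[K]_(3, n)) i j k :
  bracket (A *m Z) i j k = \det A * bracket Z i j k.
Proof.
pose u : etuple 3 n := [ffun l : 'I_3 => nth i [:: i; j; k] l].
have E (X : 'M[K]_(3, n)) : bracket X i j k = \det (colsub u X).
  by rewrite det_bracket !ffunE.
rewrite !E -det_mulmx; congr (\det _).
by apply/matrixP => a b; rewrite !mxE; apply: eq_bigr => c _; rewrite mxE.
Qed.

Lemma bracket_scale (K : comNzRingType) n lam (Y : 'M[K]_(3, n)) i j k :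
  bracket (scale_cols lam Y) i j k = lam i * lam j * lam k * bracket Y i j k.
Proof. by rewrite /bracket !mxE; ring. Qed.

(** Cramer's rule in the basis [p], [q], [r], with the axes rescaled so that [u] becomes (1, 1, 1).
    The columns [p], [q], [r] only become multiples of the unit vectors. *)
Lemma projective_frame (K : fieldType) n (X : 'M[K]_(3, n)) (p q r u : 'I_n) :
  bracket X p q r != 0 -> bracket X u q r != 0 ->
  bracket X p u r != 0 -> bracket X p q u != 0 ->
  exists2 A : 'M[K]_3, A \in unitmx & exists2 Z : 'M[K]_(3, n), X = A *m Z &
    forall j, [/\ Z 'r_0 j = bracket X j q r / bracket X u q r,
                  Z 'r_1 j = bracket X p j r / bracket X p u r &
                  Z 'r_2 j = bracket X p q j / bracket X p q u].
Proof.
move=> d0 d1 d2 d3.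
pose Z : 'M[K]_(3, n) := \matrix_(k, j)
  nth 0 [:: bracket X j q r / bracket X u q r; bracket X p j r / bracket X p u r;
            bracket X p q j / bracket X p q u] k.
pose A : 'M[K]_3 := \matrix_(k, l) (X k (nth p [:: p; q; r] l) *
  (nth 0 [:: bracket X u q r; bracket X p u r; bracket X p q u] l /
   bracket X p q r)).
have XE : X = A *m Z.
  apply/matrixP => k j; rewrite mxE sum_ord3 !mxE /=.
  have -> : X k j = (X k p * bracket X j q r + X k q * bracket X p j r +
                     X k r * bracket X p q j) / bracket X p q r.
    apply: (mulIf d0); rewrite divfK //.
    by elim/ord3_ind: k; rewrite /bracket; ring.
  by field; rewrite d0 d1 d2 d3.
exists A; last by exists Z => // j; rewrite !mxE.
rewrite unitmxE unitfE; apply: contra_neq d0.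
by rewrite XE bracket_mul => ->; rewrite mul0r.
Qed.

Lemma ord13_ind (T : 'I_13 -> Prop) :
  T 'p_0 -> T 'p_1 -> T 'p_2 -> T 'p_3 -> T 'p_4 -> T 'p_5 -> T 'p_6 ->
  T 'p_7 -> T 'p_8 -> T 'p_9 -> T 'p_10 -> T 'p_11 -> T 'p_12 -> forall j, T j.
Proof.
do 13 move=> ?; case=> [[|[|[|[|[|[|[|[|[|[|[|[|[|//]]]]]]]]]]]]] h];
  by rewrite (bool_irrelevance h isT).
Qed.

Definition normal_form (K : comNzRingType) (a t : K) : 'M[K]_(3, 13) :=
  let P := (1 + a) * t - a in
  \matrix_(k, j) nth 0 (nth [::]
    [:: [:: 1; 0; 0]; [:: 0; 1; 0]; [:: 0; 0; 1]; [:: 1; 1; 1];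
        [:: a; 1 + a; 1 + a];
        [:: t; 1; 0];
        [:: a; 1 + a; a];
        [:: 0; P; a * t];
        [:: P; 0; t - a];
        [:: (1 + a) * t; 1 + a; a];
        [:: 0; (1 + a) * P; (1 + a + a ^+ 2) * t - a];
        [:: - a ^+ 2 * (1 + t - a); (1 + a) * (t - 2 * a + a ^+ 2);
            (1 + a) * t + a ^+ 3 - a ^+ 2 - a];
        [:: a * (1 - a) - t; (1 + a) * (t - a); a * (t - a)]] j) k.

(** A collinearity solves for a coordinate in this form; dually, [neq0_factor] extracts a nonzero
    factor from a nonzero bracket. *)
Lemma cancel_factor (K : fieldType) (c u v : K) : c != 0 -> c * (u - v) = 0 -> u = v.
Proof. by move=> c0 /eqP; rewrite mulf_eq0 (negbTE c0) subr_eq0 => /eqP. Qed.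

Lemma neq0_factor (K : fieldType) (c u v : K) : c != 0 -> c = u * v -> v != 0.
Proof. by move=> c0 cE; apply: contra_neq c0 => v0; rewrite cE v0 mulr0. Qed.

(** The points are determined one after the other: a vanishing bracket is linear in the newest
    column, and nonzero brackets supply the denominators. The collinearity of 2, 11, 12 is left over
    and gives the equation. *)
Lemma normal_formP (K : fieldType) (X : 'M[K]_(3, 13)) :
  (forall i j k : 'I_13, (bracket X i j k == 0) = (chi i j k == 0)) ->
  exists2 A : 'M[K]_3, A \in unitmx & exists a t lam,
    X = A *m scale_cols lam (normal_form a t) /\ (1 - a) * (t - 2 * a) = 0.
Proof.
move=> H.
have nz (i j k : 'I_13) : chi i j k != 0 -> bracket X i j k != 0 by rewrite H.
have [||||A uA [Z XE ZE]] := @projective_frame K 13 X 'p_0 'p_1 'p_2 'p_3;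
  [by apply: nz; vm_compute..|].
have dA : \det A != 0 by rewrite -unitfE -unitmxE.
have eZ i j k : bracket Z i j k == 0 = (chi i j k == 0).
  by rewrite -H XE bracket_mul mulf_eq0 (negbTE dA).
have z (i j k : 'I_13) : chi i j k == 0 -> bracket Z i j k = 0.
  by rewrite -eZ => /eqP.
have {nz}nz (i j k : 'I_13) : chi i j k != 0 -> bracket Z i j k != 0 by rewrite eZ.
exists A => //.
have [n0 n1 n2] : [/\ bracket X 'p_3 'p_1 'p_2 != 0, bracket X 'p_0 'p_3 'p_2 != 0 &
  bracket X 'p_0 'p_1 'p_3 != 0] by rewrite !H; split; vm_compute.
have [y0 w0] : Z 'r_1 'p_0 = 0 /\ Z 'r_2 'p_0 = 0.
  by have [_ -> ->] := ZE 'p_0; split; rewrite [bracket _ _ _ _](_ : _ = 0)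
    ?mul0r // /bracket; ring.
have [x1 w1] : Z 'r_0 'p_1 = 0 /\ Z 'r_2 'p_1 = 0.
  by have [-> _ ->] := ZE 'p_1; split=> //; rewrite [bracket _ _ _ _](_ : _ = 0)
    ?mul0r // /bracket; ring.
have [x2 y2] : Z 'r_0 'p_2 = 0 /\ Z 'r_1 'p_2 = 0.
  by have [-> -> _] := ZE 'p_2; split=> //; rewrite [bracket _ _ _ _](_ : _ = 0)
    ?mul0r // /bracket; ring.
have [x3 y3 w3] : [/\ Z 'r_0 'p_3 = 1, Z 'r_1 'p_3 = 1 & Z 'r_2 'p_3 = 1].
  by have [-> -> ->] := ZE 'p_3; rewrite !divff.

have [x0n y1n w2n] : [/\ Z 'r_0 'p_0 != 0, Z 'r_1 'p_1 != 0 & Z 'r_2 'p_2 != 0].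
  have h : bracket Z 'p_0 'p_1 'p_2 != 0 by apply: nz; vm_compute.
  rewrite /bracket y0 w0 x1 w1 x2 y2 in h; split.
  - by apply: (neq0_factor h (u := Z 'r_1 'p_1 * Z 'r_2 'p_2)); ring.
  - by apply: (neq0_factor h (u := Z 'r_0 'p_0 * Z 'r_2 'p_2)); ring.
  - by apply: (neq0_factor h (u := Z 'r_0 'p_0 * Z 'r_1 'p_1)); ring.
have w4 : Z 'r_2 'p_4 = Z 'r_1 'p_4.
  have h : bracket Z 'p_0 'p_3 'p_4 = 0 by apply: z; vm_compute.
  apply: (cancel_factor x0n); rewrite -[RHS]h /bracket y0 w0 x3 y3 w3; ring.
(* In the normal form these two coordinates are [1 + a] and [a], so their difference is the column
   scaling; likewise for [l6]. *)
pose l4 := Z 'r_1 'p_4 - Z 'r_0 'p_4; pose a := Z 'r_0 'p_4 / l4.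
have l4n : l4 != 0.
  have h : bracket Z 'p_1 'p_3 'p_4 != 0 by apply: nz; vm_compute.
  apply: (neq0_factor h (u := - Z 'r_1 'p_1)).
  rewrite /bracket x1 w1 x3 y3 w3 w4 /l4; ring.
have x4 : Z 'r_0 'p_4 = l4 * a by rewrite mulrC divfK.
have y4 : Z 'r_1 'p_4 = l4 * (1 + a) by rewrite mulrDr mulr1 -x4 subrK.
rewrite y4 in w4.
have an : a != 0.
  have h : bracket Z 'p_4 'p_1 'p_2 != 0 by apply: nz; vm_compute.
  apply: (neq0_factor h (u := l4 * Z 'r_1 'p_1 * Z 'r_2 'p_2)).
  rewrite /bracket x1 w1 x2 y2 x4; ring.
have an1 : 1 + a != 0.
  have h : bracket Z 'p_0 'p_1 'p_4 != 0 by apply: nz; vm_compute.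
  apply: (neq0_factor h (u := l4 * Z 'r_0 'p_0 * Z 'r_1 'p_1)).
  rewrite /bracket y0 w0 x1 w1 w4; ring.
have w5 : Z 'r_2 'p_5 = 0.
  have h : bracket Z 'p_0 'p_1 'p_5 = 0 by apply: z; vm_compute.
  apply: (cancel_factor (mulf_neq0 x0n y1n)).
  rewrite -[RHS]h /bracket y0 w0 x1 w1; ring.
pose l5 := Z 'r_1 'p_5; pose t := Z 'r_0 'p_5 / l5.
have l5n : l5 != 0.
  have h : bracket Z 'p_0 'p_2 'p_5 != 0 by apply: nz; vm_compute.
  apply: (neq0_factor h (u := - Z 'r_0 'p_0 * Z 'r_2 'p_2)).
  rewrite /bracket y0 w0 x2 y2 w5 /l5; ring.
have x5 : Z 'r_0 'p_5 = l5 * t by rewrite mulrC divfK.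
have y5 : Z 'r_1 'p_5 = l5 by [].
pose l6 := Z 'r_1 'p_6 - Z 'r_0 'p_6.
have w6 : Z 'r_2 'p_6 = Z 'r_0 'p_6.
  have h : bracket Z 'p_1 'p_3 'p_6 = 0 by apply: z; vm_compute.
  apply: (cancel_factor y1n); apply/eqP; rewrite -oppr_eq0; apply/eqP.
  rewrite -[RHS]h /bracket x1 w1 x3 y3 w3; ring.
have x6 : Z 'r_0 'p_6 = l6 * a.
  have h : bracket Z 'p_2 'p_4 'p_6 = 0 by apply: z; vm_compute.
  apply: (cancel_factor (mulf_neq0 w2n l4n)); apply/eqP.
  rewrite -oppr_eq0; apply/eqP; rewrite -[RHS]h /bracket x2 y2 x4 y4 w4 /l6; ring.
have y6 : Z 'r_1 'p_6 = l6 * (1 + a) by rewrite mulrDr mulr1 -x6 subrK.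
rewrite x6 in w6.
have l6n : l6 != 0.
  have h : bracket Z 'p_6 'p_1 'p_2 != 0 by apply: nz; vm_compute.
  apply: (neq0_factor h (u := a * Z 'r_1 'p_1 * Z 'r_2 'p_2)).
  rewrite /bracket x1 w1 x2 y2 x6; ring.
pose P := (1 + a) * t - a.
have Pn : P != 0.
  have h : bracket Z 'p_2 'p_5 'p_6 != 0 by apply: nz; vm_compute.
  apply: (neq0_factor h (u := Z 'r_2 'p_2 * l5 * l6)).
  rewrite /bracket x2 y2 x5 y5 w5 x6 y6 w6 /P; ring.
have an1P : (1 + a) * P != 0 by rewrite mulf_neq0.
have x7 : Z 'r_0 'p_7 = 0.
  have h : bracket Z 'p_1 'p_2 'p_7 = 0 by apply: z; vm_compute.
  apply: (cancel_factor (mulf_neq0 y1n w2n)).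
  rewrite -[RHS]h /bracket x1 w1 x2 y2; ring.
pose l7 := Z 'r_1 'p_7 / P.
have y7 : Z 'r_1 'p_7 = l7 * P by rewrite divfK.
have w7 : Z 'r_2 'p_7 = l7 * (a * t).
  have h : bracket Z 'p_5 'p_6 'p_7 = 0 by apply: z; vm_compute.
  apply: (cancel_factor (mulf_neq0 (mulf_neq0 l5n l6n) Pn)).
  rewrite -[RHS]h /bracket x5 y5 w5 x6 y6 w6 x7 y7 /P; ring.
have y8 : Z 'r_1 'p_8 = 0.
  have h : bracket Z 'p_0 'p_2 'p_8 = 0 by apply: z; vm_compute.
  apply: (cancel_factor (mulf_neq0 x0n w2n)); apply/eqP; rewrite -oppr_eq0.
  by apply/eqP; rewrite -[RHS]h /bracket y0 w0 x2 y2; ring.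
pose l8 := Z 'r_0 'p_8 / P.
have x8 : Z 'r_0 'p_8 = l8 * P by rewrite divfK.
have l7n : l7 != 0.
  have h : bracket Z 'p_0 'p_7 'p_2 != 0 by apply: nz; vm_compute.
  apply: (neq0_factor h (u := Z 'r_0 'p_0 * Z 'r_2 'p_2 * P)).
  rewrite /bracket y0 w0 x2 y2 x7 y7; ring.
have w8 : Z 'r_2 'p_8 = l8 * (t - a).
  have h : bracket Z 'p_3 'p_7 'p_8 = 0 by apply: z; vm_compute.
  apply: (cancel_factor (mulf_neq0 l7n Pn)).
  rewrite -[RHS]h /bracket x3 y3 w3 x7 y7 w7 x8 y8 /P; ring.
have l8n : l8 != 0.
  have h : bracket Z 'p_8 'p_1 'p_2 != 0 by apply: nz; vm_compute.
  apply: (neq0_factor h (u := Z 'r_1 'p_1 * Z 'r_2 'p_2 * P)).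
  rewrite /bracket x1 w1 x2 y2 x8; ring.
have tan : t - a != 0.
  have h : bracket Z 'p_0 'p_1 'p_8 != 0 by apply: nz; vm_compute.
  apply: (neq0_factor h (u := l8 * Z 'r_0 'p_0 * Z 'r_1 'p_1)).
  rewrite /bracket y0 w0 x1 w1 w8; ring.
pose l9 := Z 'r_1 'p_9 / (1 + a).
have y9 : Z 'r_1 'p_9 = l9 * (1 + a) by rewrite divfK.
have x9 : Z 'r_0 'p_9 = l9 * ((1 + a) * t).
  have h : bracket Z 'p_2 'p_5 'p_9 = 0 by apply: z; vm_compute.
  apply: (cancel_factor (mulf_neq0 w2n l5n)); apply/eqP; rewrite -oppr_eq0.
  by apply/eqP; rewrite -[RHS]h /bracket x2 y2 x5 y5 w5 y9; ring.
have w9 : Z 'r_2 'p_9 = l9 * a.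
  have h : bracket Z 'p_0 'p_6 'p_9 = 0 by apply: z; vm_compute.
  apply: (cancel_factor (mulf_neq0 (mulf_neq0 x0n l6n) an1)).
  rewrite -[RHS]h /bracket y0 w0 x6 y6 w6 y9; ring.
have l9n : l9 != 0.
  have h : bracket Z 'p_0 'p_9 'p_2 != 0 by apply: nz; vm_compute.
  apply: (neq0_factor h (u := Z 'r_0 'p_0 * Z 'r_2 'p_2 * (1 + a))).
  rewrite /bracket y0 w0 x2 y2 y9; ring.
have x10 : Z 'r_0 'p_10 = 0.
  have h : bracket Z 'p_1 'p_2 'p_10 = 0 by apply: z; vm_compute.
  apply: (cancel_factor (mulf_neq0 y1n w2n)).
  rewrite -[RHS]h /bracket x1 w1 x2 y2; ring.
pose l10 := Z 'r_1 'p_10 / ((1 + a) * P).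
have y10 : Z 'r_1 'p_10 = l10 * ((1 + a) * P) by rewrite divfK.
have w10 : Z 'r_2 'p_10 = l10 * ((1 + a + a ^+ 2) * t - a).
  have h : bracket Z 'p_4 'p_8 'p_10 = 0 by apply: z; vm_compute.
  apply: (cancel_factor (mulf_neq0 (mulf_neq0 l4n l8n) an1P)).
  apply/eqP; rewrite -oppr_eq0; apply/eqP.
  rewrite -[RHS]h /bracket x4 y4 w4 x8 y8 w8 x10 y10 /P; ring.
have l10n : l10 != 0.
  have h : bracket Z 'p_0 'p_10 'p_2 != 0 by apply: nz; vm_compute.
  apply: (neq0_factor h (u := Z 'r_0 'p_0 * Z 'r_2 'p_2 * ((1 + a) * P))).
  rewrite /bracket y0 w0 x2 y2 y10; ring.
(* Point 11 is [u] times column 6 plus [l11] times column 10 of the normal form; the line through 4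
   and 9 then fixes the ratio of [u] to [l11]. *)
pose u := Z 'r_0 'p_11 / a.
pose l11 := (Z 'r_1 'p_11 - u * (1 + a)) / ((1 + a) * P).
have x11u : Z 'r_0 'p_11 = u * a by rewrite divfK.
have y11u : Z 'r_1 'p_11 = u * (1 + a) + l11 * ((1 + a) * P).
  by rewrite divfK // addrC subrK.
have w11u : Z 'r_2 'p_11 = u * a + l11 * ((1 + a + a ^+ 2) * t - a).
  have h : bracket Z 'p_6 'p_10 'p_11 = 0 by apply: z; vm_compute.
  apply: (cancel_factor (mulf_neq0 (mulf_neq0 l6n l10n) (mulf_neq0 an an1P))).
  rewrite -[RHS]h /bracket x6 y6 w6 x10 y10 w10 x11u y11u; ring.
have uE : u = - l11 * a * (1 + t - a).
  have h : bracket Z 'p_4 'p_9 'p_11 = 0 by apply: z; vm_compute.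
  apply: (cancel_factor (mulf_neq0 (mulf_neq0 l4n l9n) an1P)).
  rewrite -[RHS]h /bracket x4 y4 w4 x9 y9 w9 x11u y11u w11u /P; ring.
pose l12 := Z 'r_2 'p_12 / (a * (t - a)).
have w12 : Z 'r_2 'p_12 = l12 * (a * (t - a)) by rewrite divfK // mulf_neq0.
have y12 : Z 'r_1 'p_12 = l12 * ((1 + a) * (t - a)).
  have h : bracket Z 'p_0 'p_6 'p_12 = 0 by apply: z; vm_compute.
  apply: (cancel_factor (mulf_neq0 (mulf_neq0 x0n l6n) an)).
  apply/eqP; rewrite -oppr_eq0; apply/eqP.
  rewrite -[RHS]h /bracket y0 w0 x6 y6 w6 w12; ring.
have x12 : Z 'r_0 'p_12 = l12 * (a * (1 - a) - t).
  have h : bracket Z 'p_4 'p_8 'p_12 = 0 by apply: z; vm_compute.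
  apply: (cancel_factor (mulf_neq0 (mulf_neq0 l4n l8n) (mulf_neq0 an1 tan))).
  rewrite -[RHS]h /bracket x4 y4 w4 x8 y8 w8 y12 w12 /P; ring.
have l11n : l11 != 0.
  have h : bracket Z 'p_1 'p_2 'p_11 != 0 by apply: nz; vm_compute.
  apply: (neq0_factor h (u := - Z 'r_1 'p_1 * Z 'r_2 'p_2 * a ^+ 2 * (1 + t - a))).
  rewrite /bracket x1 w1 x2 y2 x11u uE; ring.
have l12n : l12 != 0.
  have h : bracket Z 'p_0 'p_1 'p_12 != 0 by apply: nz; vm_compute.
  apply: (neq0_factor h (u := Z 'r_0 'p_0 * Z 'r_1 'p_1 * (a * (t - a)))).
  rewrite /bracket y0 w0 x1 w1 w12; ring.
exists a, t, (fun j : 'I_13 => nth 0 [:: Z 'r_0 'p_0; Z 'r_1 'p_1; Z 'r_2 'p_2; 1;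
  l4; l5; l6; l7; l8; l9; l10; l11; l12] j); split=> //.
- rewrite XE; congr (A *m _); apply/matrixP => k j; rewrite !mxE.
  elim/ord13_ind: j; elim/ord3_ind: k => /=;
    rewrite ?(y0, w0, x1, w1, x2, y2, x3, y3, w3, x4, y4, w4, x5, y5, w5, x6, y6, w6);
    rewrite ?(x7, y7, w7, x8, y8, w8, x9, y9, w9, x10, y10, w10, x12, y12, w12);
    rewrite ?(x11u, y11u, w11u, uE) /P; ring.
- have h : bracket Z 'p_2 'p_11 'p_12 = 0 by apply: z; vm_compute.
  (* The bracket of 2, 11, 12 is this nonzero factor times [(1 - a) * (t - 2 * a)]. *)
  apply: (mulfI (mulf_neq0 (mulf_neq0 w2n (mulf_neq0 l11n l12n)) an1P)).
  rewrite mulr0 -[RHS]h /bracket x2 y2 x11u y11u x12 y12 uE /P; ring.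
Qed.

(** * The oriented matroid and the parametrization of its realizations *)

Section Realizations13.
Variable R : realType.
Implicit Types (b : bool) (x : R) (X : 'M[R]_(3, 13)).

Lemma base_in_dom : branch_dom false (1 : R).
Proof. by rewrite /branch_dom /= expr1n; split; exact: ltr01. Qed.

Lemma branch_mx_neq0 : exists i, mx_chirotope (branch_mx false (1 : R)) i != 0.
Proof.
exists [ffun k : 'I_3 => widen_ord (isT : 3 <= 13)%N k].
rewrite /mx_chirotope det_bracket sgz_bracket_branch; last exact: base_in_dom.
by rewrite !ffunE; vm_compute.
Qed.

(** The chosen matrix is the crossing point [a = 1], [t = 2]. *)
Definition om13 : orientedMatroid 3 13 := mx_orientedMatroid branch_mx_neq0.

Lemma om13E i : om13 i = chi (i 'r_0) (i 'r_1) (i 'r_2).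
Proof.
rewrite /= /mx_chirotope det_bracket sgz_bracket_branch //; exact: base_in_dom.
Qed.

(** Positive scalings preserve all signs, and [A] multiplies them by the sign of its determinant,
    whence the two cases of [realization]. *)
Lemma unitmx_realization X (A : 'M[R]_3) lam b x :
  A \in unitmx -> (forall j, 0 < lam j) -> branch_dom b x ->
  X = A *m scale_cols lam (branch_mx b x) -> realization om13 X.
Proof.
move=> uA lam0 bx XE.
have dA : \det A != 0 by rewrite -unitfE -unitmxE.
have sX i j k : sgz (bracket X i j k) = sgz (\det A) * chi i j k.
  rewrite XE bracket_mul bracket_scale sgzM; congr (_ * _).
  by rewrite !sgzM sgz_bracket_branch // !gtr0_sgz ?lam0 // !mul1r.
split; last first.
  case/orP: (lt_total dA) => h; [right | left] => i;
    rewrite om13E /mx_chirotope det_bracket sX.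
    by rewrite ltr0_sgz // mulN1r.
  by rewrite gtr0_sgz // mul1r.
(* The first three columns form an invertible submatrix, which gives the rank. *)
have bX : bracket X 'p_0 'p_1 'p_2 != 0.
  by rewrite -sgz_eq0 sX mulf_neq0 ?sgz_eq0 //; vm_compute.
pose u : etuple 3 13 := [ffun k : 'I_3 => widen_ord (isT : 3 <= 13)%N k].
have uX : colsub u X \in unitmx.
  rewrite unitmxE unitfE det_bracket !ffunE.
  by move: bX; congr (bracket _ _ _ _ != _); apply: val_inj.
apply/eqP; rewrite eqn_leq rank_leq_row /=.
rewrite -[leqLHS](mxrank_unit uX).
have -> : colsub u X = X *m colsub u 1%:M.
  by rewrite -[X in colsub u X]mulmx1; apply/matrixP => i j; rewrite !mxE;
     apply: eq_bigr => k _; rewrite !mxE.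
exact: mxrankM_maxl.
Qed.

Lemma branch_mx_realization b x :
  branch_dom b x -> realization om13 (branch_mx b x).
Proof.
move=> bx; apply: (@unitmx_realization _ 1%:M (fun=> 1) b x) => //.
  exact: unitmx1.
by rewrite scale_cols1 mul1mx.
Qed.

Lemma realization_sgz X : realization om13 X -> exists2 s : int, s * s = 1 &
  forall i j k, sgz (bracket X i j k) = s * chi i j k.
Proof.
pose u (i j k : 'I_13) : etuple 3 13 := [ffun l : 'I_3 => nth i [:: i; j; k] l].
have E i j k : mx_chirotope X (u i j k) = sgz (bracket X i j k).
  by rewrite /mx_chirotope det_bracket !ffunE.
have F i j k : om13 (u i j k) = chi i j k by rewrite om13E !ffunE.
move=> [_ [] h]; [exists 1 | exists (-1)] => // i j k;
  by rewrite -E h F ?mul1r ?mulN1r.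
Qed.

(** Two nonzero brackets that differ only by [j] in place of 0 will compare the signs of the
    scalings of these two columns. *)
Lemma chi_connected (j : 'I_13) : exists i k : 'I_13, chi j i k * chi 0 i k != 0.
Proof.
have /allP/(_ (val j)) : all (fun j => has (fun i => has (fun k =>
    chi j i k * chi 0 i k != 0) (iota 0 13)) (iota 0 13)) (iota 0 13).
  by vm_compute.
rewrite mem_iota ltn_ord => /(_ isT) /hasP [i]; rewrite mem_iota => ilt.
move=> /hasP [k]; rewrite mem_iota => klt h.
by exists (Ordinal (ilt : (i < 13)%N)), (Ordinal (klt : (k < 13)%N)).
Qed.

Lemma normal_form_true x : exists2 mu, (forall j, mu j != 0) &
  normal_form 1 (1 + x / 2) = scale_cols mu (branch_mx true x).
Proof.
exists (fun j : 'I_13 => nth 1 [:: 1; 1; 1; 1; 1; 2^-1; 1; 2^-1; 2^-1; 1; 2^-1;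
  2^-1; 2^-1] j).
  by elim/ord13_ind => /=; apply: lt0r_neq0; lra.
by apply/matrixP => k j; rewrite !mxE; elim/ord13_ind: j; elim/ord3_ind: k => /=;
  field.
Qed.

Lemma normal_form_false x : 0 < x -> exists2 mu, (forall j, mu j != 0) &
  normal_form ((1 + x) / 2) (1 + x) = scale_cols mu (branch_mx false x).
Proof.
move=> x0; set a := (1 + x) / 2; have a0 : 0 < a by rewrite /a; lra.
(* For [t = 2 * a] the columns 7, 8, 10, 11, 12 of the normal form have the common factor [a]; the
   rest clears denominators. *)
exists (fun j : 'I_13 => nth 1 [:: 1; 1; 1; 1; 2^-1; 1; 2^-1; a; a; 2^-1; a / 2;
  a / 4; a / 2] j).
  by elim/ord13_ind => /=; apply: lt0r_neq0; lra.
by apply/matrixP => k j; rewrite !mxE; elim/ord13_ind: j; elim/ord3_ind: k => /=;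
  rewrite /a; field.
Qed.

Lemma sqrM_gt0 (c d : R) : 0 < c ^+ 2 * d -> 0 < d.
Proof.
by apply: contraTT; rewrite -!leNgt => d0; rewrite mulr_ge0_le0 // sqr_ge0.
Qed.

(** [normal_formP] gives one of the two lines, and positive products of brackets place the parameter
    in its domain. The column scalings turn out to have a common sign, which moves into [A]. *)
Lemma realizationP X : realization om13 X -> exists b x,
  branch_dom b x /\ exists2 A : 'M[R]_3, A \in unitmx &
  exists2 lam, (forall j, 0 < lam j) & X = A *m scale_cols lam (branch_mx b x).
Proof.
move=> /realization_sgz[s s1 sX].
have s0 : s != 0 by apply: contra_eq_neq s1 => ->; rewrite mul0r.
have s4 (c d e f : int) : s * c * (s * d) * (s * e * (s * f)) = c * d * (e * f).
  rewrite [LHS](_ : _ = s * s * (s * s) * (c * d * (e * f))); last ring.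
  by rewrite s1 !mul1r.
have [|A uA [a [t [lam [XE at0]]]]] := @normal_formP R X.
  by move=> i j k; rewrite -[in LHS]sgz_eq0 sX mulf_eq0 (negbTE s0).
have dA : \det A != 0 by rewrite -unitfE -unitmxE.
(* In the two products of brackets below, every point occurs an even number of times,
   so the signs of [A] and of the column scalings drop out. *)
have t1 : 1 < t.
  have : 0 < bracket X 'p_0 'p_1 'p_2 * bracket X 'p_0 'p_2 'p_5 *
             (bracket X 'p_1 'p_2 'p_3 * bracket X 'p_2 'p_3 'p_5).
    by rewrite -sgz_gt0 !sgzM !sX s4; vm_compute.
  rewrite XE !bracket_mul !bracket_scale [ltRHS](_ : _ = (\det A ^+ 2 * lam 'p_0 *
    lam 'p_1 * lam 'p_2 ^+ 2 * lam 'p_3 * lam 'p_5) ^+ 2 * (t - 1)).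
    by move/sqrM_gt0; rewrite subr_gt0.
  by rewrite /bracket !mxE /=; ring.
suff [b [x [bx [mu mu0 E]]]] : exists b x, branch_dom b x /\
    exists2 mu, (forall j, mu j != 0) & normal_form a t = scale_cols mu (branch_mx b x).
  exists b, x; split=> //; pose nu j := lam j * mu j.
  have {}XE : X = A *m scale_cols nu (branch_mx b x).
    by rewrite XE E; congr (_ *m _); apply/matrixP => k j; rewrite !mxE mulrA.
  (* By [sg] the two brackets of [chi_connected] give products of equal sign [s], and their common
     factors form a square. *)
  have nuj j : 0 < nu 'p_0 * nu j.
    have [i [k]] := chi_connected j; rewrite mulf_eq0 negb_or => /andP[cj c0].
    have sg (l : 'I_13) : chi l i k != 0 -> sgz (\det A * (nu l * nu i * nu k)) = s.
      move=> cl; apply: (mulIf cl); rewrite -sX XE bracket_mul bracket_scale.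
      by rewrite [in RHS]mulrA [RHS]sgzM sgz_bracket_branch.
    have : 0 < \det A * (nu 'p_0 * nu i * nu k) * (\det A * (nu j * nu i * nu k)).
      by rewrite -sgz_gt0 sgzM !sg ?s1.
    rewrite [ltRHS](_ : _ = (\det A * nu i * nu k) ^+ 2 * (nu 'p_0 * nu j)); last ring.
    exact: sqrM_gt0.
  have nu0 : nu 'p_0 != 0 by apply: contraTneq (nuj 'p_0) => ->; rewrite mul0r ltxx.
  exists (nu 'p_0 *: A); first by rewrite unitmxZ ?unitfE.
  exists (fun j => nu j / nu 'p_0).
    move=> j; rewrite (_ : _ / _ = nu 'p_0 * nu j / (nu 'p_0 * nu 'p_0)).
      by rewrite divr_gt0.
    by field.
  rewrite XE -scalemxAl scalemxAr; congr (_ *m _); apply/matrixP => k j.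
  by rewrite !mxE; field.
move/eqP: at0; rewrite mulf_eq0 => /orP[/eqP a1E|/eqP t2].
  exists true, (2 * (t - 1)); split; last first.
    rewrite (_ : a = 1); last lra.
    rewrite [X in normal_form _ X](_ : t = 1 + 2 * (t - 1) / 2); last by field.
    exact: normal_form_true.
  have : 0 < bracket X 'p_1 'p_2 'p_4 * bracket X 'p_1 'p_8 'p_9 *
             (bracket X 'p_2 'p_4 'p_5 * bracket X 'p_5 'p_8 'p_9).
    by rewrite -sgz_gt0 !sgzM !sX s4; vm_compute.
  have {a1E}aE : a = 1 by lra.
  (* For [x = 2 * (t - 1)], the last factor is [(x ^+ 2 - 2) / 2]. *)
  rewrite XE aE !bracket_mul !bracket_scale [ltRHS](_ : _ = (\det A ^+ 2 *
    lam 'p_1 * lam 'p_2 * lam 'p_4 * lam 'p_5 * lam 'p_8 * lam 'p_9 *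
    (1 - 2 * t)) ^+ 2 * (2 * t ^+ 2 - 4 * t + 1)).
    by move/sqrM_gt0 => h; split; rewrite /= -?pmulrn; lra.
  by rewrite /bracket !mxE /=; ring.
exists false, (t - 1); split.
  by split; rewrite ?exprn_gt0 ?subr_gt0.
rewrite (_ : a = (1 + (t - 1)) / 2); last by lra.
rewrite [X in normal_form _ X](_ : t = 1 + (t - 1)); last by lra.
by apply: normal_form_false; rewrite subr_gt0.
Qed.

End Realizations13.

(** * Connectedness *)

Lemma mx_continuous (T U : topologicalType) m n (F : T -> 'M[U]_(m, n)) :
  (forall i j, continuous (fun t => F t i j)) -> continuous F.
Proof.
move=> cF t A [P nP sPA].
apply: (@filterS _ (nbhs t) _ [set u | forall i j, P i j (F u i j)]).
  by move=> u; exact: sPA.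
by apply: filter_forall => i; apply: filter_forall => j; apply: (cF i j t).
Qed.

Section Connected.
Variable R : realType.
Implicit Types (b : bool) (x : R).
Local Notation space := (realization_space R (om13 R)).
Local Notation real_set := (set_type (@realizations R 3 13 (om13 R))).

Lemma peval_continuous (p : seq int) : continuous (fun x : R => peval p x).
Proof.
elim: p => [|a p IH] x; first exact: cvg_cst.
by apply: cvgD; [exact: cvg_cst | apply: cvgM; [exact: cvg_id | exact: IH]].
Qed.

(** The parameter of the crossing point [a = 1], [t = 2] on each branch. *)
Definition meeting b : R := if b then 2 else 1.

Lemma meeting_dom b : branch_dom b (meeting b).
Proof.
by case: b; split; rewrite /= -?pmulrn ?expr1n ?ltr01 //; lra.
Qed.

(** The branches clear denominators differently, so at the crossing point their columns agree only
    up to positive factors. *)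
Lemma meeting_mx b : exists2 mu : 'I_13 -> R, (forall j, 0 < mu j) &
  branch_mx false 1 = scale_cols mu (branch_mx b (meeting b)).
Proof.
case: b; last first.
  exists (fun=> 1) => [j|]; first exact: ltr01.
  by apply/matrixP => k j; rewrite !mxE mul1r.
exists (fun j : 'I_13 => nth 1 [:: 1; 1; 1; 1; 2; 2^-1; 2; 2^-1; 2^-1; 2; 1; 2; 1] j).
  by elim/ord13_ind => /=; lra.
by apply/matrixP => k j; rewrite !mxE; elim/ord13_ind: j; elim/ord3_ind: k => /=;
  field.
Qed.

(* A convex combination for every real [s], so that paths are defined on all of [R]. *)
Definition mix (u v : R) (s : R) : R := cos s ^+ 2 * u + sin s ^+ 2 * v.

Lemma mix_continuous u v : continuous (mix u v).
Proof.
move=> s; have cc : cos x @[x --> s] --> cos s by exact: continuous_cos.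
have cs : sin x @[x --> s] --> sin s by exact: continuous_sin.
by apply: cvgD; (apply: cvgM; last exact: cvg_cst);
   [exact: (cvgM cc cc) | exact: (cvgM cs cs)].
Qed.

Lemma mix_ge_min u v s : Num.min u v <= mix u v s.
Proof.
rewrite -[leLHS]mul1r -(cos2Dsin2 s) mulrDl.
by rewrite lerD // ler_wpM2l ?sqr_ge0 // ge_min lexx ?orbT.
Qed.

Lemma mix_gt0 u v s : 0 < u -> 0 < v -> 0 < mix u v s.
Proof. by move=> u0 v0; apply: lt_le_trans (mix_ge_min u v s); rewrite lt_min u0. Qed.

Lemma mix_dom b x y s : branch_dom b x -> branch_dom b y -> branch_dom b (mix x y s).
Proof.
move=> [x0 xc] [y0 yc]; split; first exact: mix_gt0.
have m0 : 0 < Num.min x y by rewrite lt_min x0.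
apply: (@lt_le_trans _ _ (Num.min x y ^+ 2)); first by rewrite minEle; case: ifP.
by rewrite lerXn2r ?mix_ge_min // nnegrE ltW // mix_gt0.
Qed.

Definition class_of (u : real_set) : space :=
  \pi_({eq_quot (@real_equivRel R 3 13 (om13 R))})%qT u.

Lemma realizationsP (u : real_set) : realization (om13 R) (val u).
Proof. by have /set_mem := valP u. Qed.

Definition base : real_set :=
  exist _ (branch_mx false 1) (mem_set (A := realizations (om13 R))
    (branch_mx_realization (base_in_dom R))).

(** Passing to classes removes [A]. A path then moves the parameter to the crossing point and the
    scalings to those of [meeting_mx]; it starts at [s = 0] and reaches the base at [s = pi / 2]. *)
Lemma connected_to_base (q : space) :
  exists C : set space, [/\ connected C, C (class_of base) & C q].
Proof.
have [b [x [bx [A uA [lam lam0 qE]]]]] := realizationP (realizationsP (repr q)).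
have [mu mu0 muE] := meeting_mx b.
pose lam_ s (j : 'I_13) := mix (lam j) (mu j) s.
pose F s := scale_cols (lam_ s) (branch_mx b (mix x (meeting b) s)).
have FR s : F s \in @realizations R 3 13 (om13 R).
  apply/mem_set; apply: (@unitmx_realization R _ 1%:M (lam_ s) b
    (mix x (meeting b) s)); rewrite ?unitmx1 //.
  - by move=> j; apply: mix_gt0.
  - by apply: mix_dom => //; exact: meeting_dom.
  - by rewrite mul1mx.
pose G s : real_set := exist _ (F s) (FR s).
have cG : continuous (class_of \o G).
  move=> s; apply: continuous_comp; last exact: pi_continuous.
  apply: (@continuous_comp_initial _ _ _ set_val).
  apply: mx_continuous => i j.
  rewrite [X in continuous X](_ : _ =
    fun s => lam_ s j * peval (entry b j i) (mix x (meeting b) s)).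
    move=> s'; apply: cvgM; first exact: mix_continuous.
    by apply: continuous_comp; [exact: mix_continuous | exact: peval_continuous].
  by apply/funext => s'; rewrite /= !mxE.
exists (range (class_of \o G)); split.
- apply: connected_continuous_connected; last exact: continuous_subspaceT.
  exact/connected_intervalP.
- exists (pi / 2) => //=; congr class_of; apply: val_inj => /=.
  rewrite muE /F /lam_ /mix; apply/matrixP => k j.
  by rewrite !mxE cos_pihalf sin_pihalf expr0n /= expr1n !mul0r !add0r !mul1r.
- exists 0 => //=; rewrite -[RHS]reprK; apply/eqP; rewrite eqmodE /=.
  apply/asboolP; exists A => //=; rewrite qE; congr (_ *m _); apply/matrixP => k j.
  by rewrite !mxE /lam_ /mix cos0 sin0 expr0n expr1n !mul0r !addr0 !mul1r.
Qed.

Lemma realization_space_connected : connected [set: space].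
Proof.
pose P (C : set space) := connected C /\ C (class_of base).
have -> : [set: space] = \bigcup_(C in P) C.
  apply/seteqP; split=> // q _; have [C [cC C0 Cq]] := connected_to_base q.
  by exists C.
by apply: bigcup_connected => [|C []//]; exists (class_of base) => C [].
Qed.

End Connected.

(** * Reducibility *)

Section RowSpace.
Variables (R : realType) (r n : nat).
Implicit Types X : 'M[R]_(r, n).

(** As an image, the row space is accessible to rank-nullity and its vectors are explicit
    products. *)
Lemma row_spaceE X : row_space X = limg (linfun (mulmxr X)).
Proof.
apply/eqP; rewrite eqEsubv; apply/andP; split.
  apply/span_subvP => _ /mapP[i _ ->]; apply/memv_imgP.
  by exists (delta_mx 0 i); rewrite ?memvf // lfunE /= -rowE.
apply/subvP => _ /memv_imgP[w _ ->]; rewrite lfunE /= mulmx_sum_row.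
by apply: rpred_sum => i _; rewrite rpredZ // memv_span // fintype.image_f.
Qed.

Lemma dim_row_space X : \rank X = r -> \dim (row_space X) = r.
Proof.
move=> rX; rewrite row_spaceE limg_dim_eq ?dimvf ?dim_matrix ?mul1r //.
apply/eqP; rewrite capfv -subv0; apply/subvP => w; rewrite memv_ker lfunE /= memv0.
move/eqP => wX; apply/eqP; have fX : row_free X by rewrite /row_free rX.
by apply: (row_free_inj fX); rewrite wX mul0mx.
Qed.

(** An arbitrary factor [A] suffices later: a homogeneous equation in the brackets that holds at [X]
    also holds at [A *m X]. *)
Lemma row_space_mulmx X X' : row_space X' = row_space X ->
  exists A : 'M[R]_r, X' = A *m X.
Proof.
move=> E; have h i : exists w : 'rV[R]_r, row i X' = w *m X.
  have : row i X' \in row_space X by rewrite -E memv_span // fintype.image_f.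
  by rewrite row_spaceE => /memv_imgP[w _]; rewrite lfunE /= => ->; exists w.
have [w wE] := choice h; exists (\matrix_i w i).
by apply/row_matrixP => i; rewrite row_mul rowK.
Qed.

Definition hypersurface (p : mpoly #|{: etuple r n}| R) : set {vspace 'rV[R]_n} :=
  [set U | grassmannian r U /\
    forall X : 'M[R]_(r, n), row_space X = U -> meval (plucker X) p = 0].

Lemma hypersurface_closed p d : p \is ishomog1 d mdeg ->
  zariski_closed r (hypersurface p).
Proof.
move=> hp; exists [set p]; split=> [_ ->|]; first by exists d.
apply/seteqP; split=> U [dU h]; split=> // X XU; last exact: h.
by move=> _ ->; exact: h.
Qed.

(** [repr] may return another realization of the class, but one with the same row space. *)
Lemma class_row_spaceP (M : orientedMatroid r n) :
  range (@class_row_space R r n M) = [set row_space X | X in realizations M].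
Proof.
apply/seteqP; split=> [_ [q _ <-]|_ [X MX <-]].
  rewrite /class_row_space; set u := repr _.
  by exists (val u) => //; have /set_mem := valP u.
pose u : set_type (realizations M) := exist _ X (mem_set MX).
exists (\pi_({eq_quot (real_equivRel R M)})%qT u) => //.
apply: linearly_equivalent_row_space; apply/asboolP.
rewrite -[X]/(val u); apply/(eqmodP (real_equivRel R M)).
by rewrite reprK.
Qed.

End RowSpace.

(** * Two proper closed subsets covering the realization space *)

Section Irreducibility.
Variable R : realType.
Implicit Types (X Y : 'M[R]_(3, 13)) (i j k : 'I_13).

Definition bracket_mpoly i j k : mpoly #|{: etuple 3 13}| R :=
  mpolyX R (mnm1 (enum_rank ([ffun l : 'I_3 => nth i [:: i; j; k] l] : etuple 3 13))).

Lemma meval_bracket X i j k :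
  meval (plucker X) (bracket_mpoly i j k) = bracket X i j k.
Proof. by rewrite mevalXU /plucker enum_rankK det_bracket !ffunE. Qed.

Lemma bracket_mpoly_homog i j k : bracket_mpoly i j k \is ishomog1 1 mdeg.
Proof. by rewrite dhomogX; apply/eqP; exact: mdeg1. Qed.

(* In the coordinates of [normal_form], [a / (1 + a)] is the quotient of the two
   products in [eqn_a], and [t] is [[512] [032] / ([052] [312])]. *)
Definition eqn_a : mpoly #|{: etuple 3 13}| R :=
  bracket_mpoly 'p_4 'p_1 'p_2 * bracket_mpoly 'p_0 'p_1 'p_3 *+ 2
  - bracket_mpoly 'p_0 'p_1 'p_4 * bracket_mpoly 'p_3 'p_1 'p_2.

(** Since [a] is the quotient of [[412] [013]] by [[014] [312] - [412] [013]], this is [t = 2 * a]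
    with denominators cleared. *)
Definition eqn_at : mpoly #|{: etuple 3 13}| R :=
  bracket_mpoly 'p_5 'p_1 'p_2 * bracket_mpoly 'p_0 'p_3 'p_2 *
    (bracket_mpoly 'p_0 'p_1 'p_4 * bracket_mpoly 'p_3 'p_1 'p_2
     - bracket_mpoly 'p_4 'p_1 'p_2 * bracket_mpoly 'p_0 'p_1 'p_3)
  - bracket_mpoly 'p_4 'p_1 'p_2 * bracket_mpoly 'p_0 'p_1 'p_3 *
    (bracket_mpoly 'p_0 'p_5 'p_2 * bracket_mpoly 'p_3 'p_1 'p_2) *+ 2.

Lemma eqn_a_homog : eqn_a \is ishomog1 2 mdeg.
Proof.
by rewrite rpredB ?rpredMn // (@dhomogM _ _ _ 1 _ 1) ?bracket_mpoly_homog.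
Qed.

Lemma eqn_at_homog : eqn_at \is ishomog1 4 mdeg.
Proof.
have h2 i j k i' j' k' :
    bracket_mpoly i j k * bracket_mpoly i' j' k' \is ishomog1 2 mdeg.
  by rewrite (@dhomogM _ _ _ 1 _ 1) ?bracket_mpoly_homog.
by rewrite rpredB ?rpredMn // (@dhomogM _ _ _ 2 _ 2) ?rpredB.
Qed.

(** Every term contains the same points with the same multiplicities, so the column scalings factor
    out along with the determinant. *)
Lemma eqn_a_transform (A : 'M[R]_3) lam Y :
  meval (plucker (A *m scale_cols lam Y)) eqn_a =
  \det A ^+ 2 * lam 'p_0 * lam 'p_1 ^+ 2 * lam 'p_2 * lam 'p_3 * lam 'p_4 *
  meval (plucker Y) eqn_a.
Proof.
rewrite /eqn_a !(mevalB, mevalMn, mevalM, meval_bracket) !bracket_mul.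
by rewrite !bracket_scale; ring.
Qed.

Lemma eqn_at_transform (A : 'M[R]_3) lam Y :
  meval (plucker (A *m scale_cols lam Y)) eqn_at =
  \det A ^+ 4 * lam 'p_0 ^+ 2 * lam 'p_1 ^+ 3 * lam 'p_2 ^+ 3 * lam 'p_3 ^+ 2 *
  lam 'p_4 * lam 'p_5 * meval (plucker Y) eqn_at.
Proof.
rewrite /eqn_at !(mevalB, mevalMn, mevalM, meval_bracket) !bracket_mul.
by rewrite !bracket_scale; ring.
Qed.

Lemma eqn_a_branch b x : meval (plucker (branch_mx b x)) eqn_a =
  if b then 0 else x - 1 :> R.
Proof.
rewrite /eqn_a !(mevalB, mevalMn, mevalM, meval_bracket) /bracket !mxE /=.
by case: b => /=; ring.
Qed.

Lemma eqn_at_branch b x : meval (plucker (branch_mx b x)) eqn_at =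
  if b then x - 2 else 0 :> R.
Proof.
rewrite /eqn_at !(mevalB, mevalMn, mevalM, meval_bracket) /bracket !mxE /=.
by case: b => /=; ring.
Qed.

Lemma om13_not_irreducible :
  ~ zariski_irreducible 3 (range (@class_row_space R 3 13 (om13 R))).
Proof.
rewrite class_row_spaceP; set S := [set _ | _ in _]; case=> _; apply.
have dimS X : realization (om13 R) X -> grassmannian 3 (row_space X).
  by move=> [rX _]; exact: dim_row_space.
(* The first set contains the branch [true], the second the branch [false]. *)
exists (S `&` hypersurface eqn_a), (S `&` hypersurface eqn_at).
have notin p b x : branch_dom b x -> meval (plucker (branch_mx b x)) p != 0 ->
    ~ S `<=` S `&` hypersurface p.
  move=> bx p0 /(_ (row_space (branch_mx b x)))[].
    by exists (branch_mx b x) => //; exact: branch_mx_realization.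
  by move=> _ [_ /(_ _ erefl)/eqP]; rewrite (negbTE p0).
split.
- by exists (hypersurface eqn_a) => //; exact: hypersurface_closed eqn_a_homog.
- by exists (hypersurface eqn_at) => //; exact: hypersurface_closed eqn_at_homog.
- split; first exact: subIsetl.
  (* Any point of this branch other than the crossing point [x = 1] would do. *)
  apply: (@notin _ false 2).
    by split; rewrite /= -?pmulrn; lra.
  by rewrite eqn_a_branch; apply: lt0r_neq0; lra.
- split; first exact: subIsetl.
  (* Here the crossing point to be avoided is [x = 2]. *)
  apply: (@notin _ true 3).
    by split; rewrite /= -?pmulrn; lra.
  by rewrite eqn_at_branch; apply: lt0r_neq0; lra.
- apply/seteqP; split=> [_ [X MX <-]|U [[]|[]]] //.
  have [b [x [_ [A _ [lam _ XE]]]]] := realizationP MX.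
  have SX : S (row_space X) by exists X.
  case: b XE => XE; [left|right]; split=> //; split; try exact: dimS;
    move=> X' /row_space_mulmx[D ->]; rewrite XE mulmxA.
    by rewrite eqn_a_transform eqn_a_branch mulr0.
  by rewrite eqn_at_transform eqn_at_branch mulr0.
Qed.

End Irreducibility.

Theorem theorem1p4 (R : realType) :
  exists M : orientedMatroid 3 13,
    [/\ [set: realization_space R M] !=set0,
        connected [set: realization_space R M] &
        ~ zariski_irreducible 3 (range (@class_row_space R 3 13 M))].
Proof.
exists (om13 R); split.
- by exists (class_of (base R)).
- exact: realization_space_connected.
- exact: om13_not_irreducible.
Qed.
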